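(* For every cubic bridgeless graph $G$ and every integer $k\ge 4$, $m_{k-1}(G)\ge \tfrac{k-1}{k}\, m_k(G)+\tfrac{1}{3k}$.
   Context: A cubic bridgeless graph is a graph in which every vertex has degree 3 and each connected component is 2-edge-connected. A perfect matching of $G$ is a set of edges such that every vertex is incident to exactly one of them. For a cubic bridgeless graph $G$ and a positive integer $t$, $m_t(G)$ denotes the maximum, over all choices of $t$ perfect matchings $M_1,\dots,M_t$ of $G$, of $|M_1\cup\dots\cup M_t|/|E(G)|$. *)

(* Defs.v *)
From mathcomp Require Import all_boot all_order all_algebra.

Set Implicit Arguments.
Unset Strict Implicit.
Unset Printing Implicit Defensive.

Import Order.TTheory GRing.Theory Num.Theory.
Local Open Scope ring_scope.

(* Finite graphs, parallel edges allowed. Loops need not be considered: in a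
   cubic graph, the third edge at a vertex carrying a loop is a bridge. *)
Record graph := Graph {
  vertex : finType;
  edge : finType;
  ends : edge -> {set vertex};
  card_ends : forall e, #|ends e| = 2%N }.

Definition degree (G : graph) (v : vertex G) : nat :=
  #|[set e : edge G | v \in ends e]|.

Definition cubic (G : graph) : Prop := forall v : vertex G, degree v = 3%N.

Definition adj (G : graph) (F : {set edge G}) : rel (vertex G) :=
  fun x y => [exists e in F, ends e == [set x; y]].

Definition component (G : graph) (x : vertex G) : {set vertex G} :=
  [set y | connect (adj [set: edge G]) x y].

Definition edges_within (G : graph) (C : {set vertex G}) : {set edge G} :=
  [set e | ends e \subset C].

(* The subgraph induced by [C] is connected, and stays so after the deletion
   of any single edge. *)
Definition two_edge_connected (G : graph) (C : {set vertex G}) : Prop :=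
  forall S : {set edge G}, (#|S| <= 1)%N ->
    {in C &, forall x y, connect (adj (edges_within C :\: S)) x y}.

Definition bridgeless (G : graph) : Prop :=
  forall x : vertex G, two_edge_connected (component x).

Definition perfect_matching (G : graph) (M : {set edge G}) : bool :=
  [forall v : vertex G, #|[set e in M | v \in ends e]| == 1%N].

(* The default value 0 is only reached when [G] has no perfect matching, which
   Petersen's theorem excludes for cubic bridgeless graphs. The [M i] need not
   be distinct. *)
Definition m (t : nat) (G : graph) : rat :=
  \big[Num.max/0]_(M : {ffun 'I_t -> {set edge G}} |
                   [forall i, perfect_matching (M i)])
     (#|\bigcup_(i < t) M i|%:R / #|edge G|%:R).

(* Main.v *)
(** Petersen's theorem guarantees that the maxima are attained. Given [k >= 4]
    perfect matchings attaining [m k G], two of them share one of the three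
    edges at each vertex, so at least a third of the edges are covered twice.
    Deleting one matching loses only edges covered once; averaging over the
    deleted matching gives the inequality.

    For Petersen's theorem, extend the adjacency relation to an edge-maximal
    one without perfect matching (Lovász). Off its set [S] of universal vertices
    adjacency is an equivalence, and a maximum matching shows that there are
    more than [#|S|] odd classes. By parity and bridgelessness at least three
    edges of the cubic graph leave each odd class, all of them towards [S], so
    that [S] would receive more than [3 * #|S|] edges. *)
Require Import Defs.
From mathcomp Require Import all_boot all_order all_algebra.
From mathcomp Require Import zify ring.
Set Implicit Arguments.
Unset Strict Implicit.
Unset Printing Implicit Defensive.

Import Order.TTheory GRing.Theory Num.Theory.

(** * Matchings of a relation as involutions *)

(* The fixed points of [f] are the unmatched vertices, which is why [e] is made
   reflexive when partial matchings are considered. *)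
Definition rel_matching (T : Type) (e : rel T) (f : T -> T) : Prop :=
  involutive f /\ forall t, e t (f t).

Definition rel_perfect_matching (T : eqType) (e : rel T) (f : T -> T) : Prop :=
  rel_matching e f /\ forall t, f t != t.

Definition add_pair (T : eqType) (e : rel T) (x z : T) : rel T :=
  fun s t => [|| e s t, (s == x) && (t == z) | (s == z) && (t == x)].

(** * Alternating walks and the exchange of two matchings *)

Section Alternating.
Variables (T : finType) (f g : T -> T).
Hypotheses (fK : involutive f) (gK : involutive g).
Hypotheses (f_free : forall t, f t != t) (g_free : forall t, g t != t).

Let h t := g (f t).

Let h_inj : injective h.
Proof. by move=> a b /(inv_inj gK) /(inv_inj fK). Qed.

(** Peeling one step off each end of the walk lowers [n] by two, until [g] or [f] would have a fixed
    point. *)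
Lemma alternating_walk_parity n w : iter n h w != g w.
Proof.
elim/ltn_ind: n w => -[|[|n]] IH w; first by rewrite eq_sym.
  by rewrite /= (inj_eq (inv_inj gK)).
apply/eqP => /= /(inv_inj gK) /(congr1 f); rewrite fK.
rewrite -iterS iterSr => E; have := IH n (leqnSn n.+1) (h w).
by rewrite E /h gK eqxx.
Qed.

Variables (e : rel T) (x y z w : T).
Hypotheses (e_sym : symmetric e) (exy : e x y) (ezy : e z y).
Hypotheses (fx : f x = z) (gy : g y = w).
Hypotheses (fe : forall t, t != x -> t != z -> e t (f t)).
Hypotheses (ge : forall t, t != y -> t != w -> e t (g t)).
Hypotheses (wx : w != x) (wz : w != z).

Let gw : g w = y. Proof. by rewrite -gy gK. Qed.

(* The alternating cycle through [y] and [w] avoids [x] and [z]: follow [f] on this cycle and [g] elsewhere. *)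
Lemma exchange_disjoint :
  ~~ fconnect h w x -> ~~ fconnect h w z -> exists p, rel_perfect_matching e p.
Proof.
move=> nx nz.
(* The [h]-orbit of [w] holds every other vertex of the cycle; [f] supplies the rest. *)
pose C t := fconnect h w t || fconnect h w (f t).
have Cf t : C (f t) = C t by rewrite /C fK orbC.
have Cg1 t : C t -> C (g t).
  have hC s : fconnect h w (g (f s)) = fconnect h w s.
    apply/idP/idP => [|H]; last by apply: connect_trans H (fconnect1 h s).
    move=> H; apply: connect_trans H _.
    by rewrite fconnect_sym //; exact: fconnect1.
  by case/orP=> H; apply/orP; [right; rewrite -hC fK gK|left; rewrite -hC fK in H].
have Cg t : C (g t) = C t.
  by apply/idP/idP => /Cg1 //; rewrite gK.
have Cw : C w by rewrite /C connect0.
have Cy : C y by rewrite -gw Cg.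
have Cx : ~~ C x by rewrite /C fx negb_or nx.
have Cz : ~~ C z by rewrite -fx Cf.
exists (fun t => if C t then f t else g t); split; last by move=> t; case: ifP.
split=> t /=; have [Ct|Ct] := boolP (C t).
- by rewrite Cf Ct fK.
- by rewrite Cg (negPf Ct) gK.
- by apply: fe; apply: contraTneq Ct => ->.
- by apply: ge; apply: contraNneq Ct => ->.
Qed.

(* The walk [w, f w, g (f w), ...] meets [x] before [z]: close it up by the edge [x y]. *)
Lemma exchange_walk n : iter n h w = x ->
  (forall i, i < n -> iter i h w != x /\ iter i h w != z) ->
  exists p, rel_perfect_matching e p.
Proof.
move=> hn before.
have n_gt0 : 0 < n by case: n hn before => // /eqP; rewrite (negPf wx).
(* [Q] consists of the vertices of the walk before [x], paired up by [f]. *)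
pose Q t := (t \in traject h w n) || (f t \in traject h w n).
have QE t : reflect (exists2 i, i < n & t = iter i h w \/ t = f (iter i h w)) (Q t).
  apply: (iffP orP) => [[] /trajectP[i ilt E]|[i ilt [E|E]]].
  - by exists i => //; left.
  - by exists i => //; right; rewrite -E fK.
  - by left; apply/trajectP; exists i.
  - by right; apply/trajectP; exists i => //; rewrite E fK.
have Qf t : Q (f t) = Q t by rewrite /Q fK orbC.
have Qx : ~~ Q x.
  apply/QE => -[i /before[ix iz] [E|E]]; first by rewrite -E eqxx in ix.
  by move: iz; rewrite -fx E fK eqxx.
have Qz : ~~ Q z by rewrite -fx Qf.
have Qy : ~~ Q y.
  apply/QE => -[i ilt [E|E]].
    by have := alternating_walk_parity i w; rewrite -E gw eqxx.
  (* The walk would close up after [i.+1] steps and so reach [x] before step [n]. *)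
  have per : iter i.+1 h w = w by rewrite /= /h -E.
  have [] := before (n - i.+1); first by lia.
  by rewrite -[w in X in X != _]per -iterD subnK // hn eqxx.
have Qw : Q w by apply/QE; exists 0 => //; left.
have xy : x != y.
  apply/eqP => xy; have := alternating_walk_parity n w.
  by rewrite hn gw xy eqxx.
(* [g] keeps [Q] inside [Q] except at the two ends of the walk, which it sends to [y] and [x]. *)
have Qg t : t != x -> t != y -> ~~ Q t -> [/\ g t != x, g t != y & ~~ Q (g t)].
  move=> tx ty nQ; split.
  - apply: contraNneq nQ => E; apply/QE; exists n.-1; first by rewrite prednK.
    right; apply: (inv_inj gK); rewrite E -hn -[in LHS](prednK n_gt0) //.
  - by apply: contraNneq nQ => E; rewrite -(gK t) E gy.
  - apply: contraNN nQ => /QE [[|i] ilt [E|E]].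
    + by move: ty; rewrite -(gK t) E /= gw eqxx.
    + have E' : t = iter 1 h w by rewrite /= /h -E gK.
      have [n1|n1] := eqVneq n 1; first by rewrite E' -n1 hn eqxx in tx.
      by apply/QE; exists 1; [lia|left].
    + apply/QE; exists i; first by lia.
      by right; apply: (inv_inj gK); rewrite E.
    + have E' : t = iter i.+2 h w by rewrite -(gK t) E.
      have [n1|n1] := eqVneq n i.+2; first by rewrite E' -n1 hn eqxx in tx.
      by apply/QE; exists i.+2; [lia|left].
pose p t := if t == x then y else if t == y then x else if Q t then f t else g t.
have px : p x = y by rewrite /p eqxx.
have py : p y = x by rewrite /p eq_sym (negPf xy) eqxx.
have pQ t : Q t -> p t = f t.
  move=> Qt; have tx : t != x by apply: contraTneq Qt => ->.
  have ty : t != y by apply: contraTneq Qt => ->.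
  by rewrite /p (negPf tx) (negPf ty) Qt.
have pg t : t != x -> t != y -> ~~ Q t -> p t = g t.
  by rewrite /p => /negPf-> /negPf-> /negPf->.
exists p.
have H t : p (p t) = t /\ e t (p t) /\ p t != t.
  have [->|tx] := eqVneq t x; first by rewrite px py eq_sym xy.
  have [->|ty] := eqVneq t y; first by rewrite py px e_sym.
  have [Qt|Qt] := boolP (Q t).
    rewrite !pQ ?Qf ?fK ?f_free //; do 2!split=> //.
    by apply: fe => //; apply: contraTneq Qt => ->.
  have [gx gy' Qgt] := Qg _ tx ty Qt.
  rewrite !pg // gK g_free; do 2!split=> //.
  by apply: ge => //; apply: contraNneq Qt => ->.
by split; [split=> t|move=> t]; case: (H t) => ? [].
Qed.

End Alternating.

(** If the alternating cycle through [y] and [w] misses [x] and [z], the matchings are switched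
    along it. Otherwise the walk from [w] to the first of [x], [z] is closed up by the edge from
    that vertex to [y]. *)
Lemma rel_perfect_matching_exchange (T : finType) (e : rel T) (x y z w : T)
    (f g : T -> T) :
  symmetric e -> e x y -> e y z -> ~~ e x z -> ~~ e y w ->
  rel_perfect_matching (add_pair e x z) f ->
  rel_perfect_matching (add_pair e y w) g ->
  exists p, rel_perfect_matching e p.
Proof.
move=> es exy eyz nxz nyw [[fK fe] ff] [[gK ge] gf].
have ezy : e z y by rewrite es.
have wx : w != x by apply: contraNneq nyw => ->; rewrite es.
have wz : w != z by apply: contraNneq nyw => ->.
(* A perfect matching that avoids the added pair is already one of [e]. *)
have use a b p : involutive p -> (forall t, add_pair e a b t (p t)) ->
    (forall t, p t != t) ->
    (forall t, t != a -> t != b -> e t (p t)) /\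
    ((exists q, rel_perfect_matching e q) \/ p a = b).
  move=> pK pe pf; split=> [t ta tb|].
    by have := pe t; rewrite /add_pair (negPf ta) (negPf tb) !orbF.
  have [|ne] := eqVneq (p a) b; first by right.
  left; exists p; split=> //; split=> // t; have /or3P[//| |] := pe t.
    by case/andP=> /eqP-> /eqP E; rewrite E eqxx in ne.
  by case/andP=> /eqP-> /eqP E; rewrite -{1}E pK eqxx in ne.
have [fe' [//|fx]] := use _ _ _ fK fe ff.
have [ge' [//|gy]] := use _ _ _ gK ge gf.
have fz : f z = x by rewrite -fx fK.
pose h t := g (f t).
have [|nx] := boolP (fconnect h w x || fconnect h w z); last first.
  by move: nx; rewrite negb_or => /andP[]; exact: (exchange_disjoint fK gK ff gf fx gy).
move=> hit; have ex : exists n, iter n h w \in [:: x; z].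
  by case/orP: hit => /iter_findex E; [exists (findex h w x)|exists (findex h w z)];
    rewrite E !inE eqxx ?orbT.
case: (ex_minnP ex) => n; rewrite !inE => hn min.
have before i : i < n -> iter i h w != x /\ iter i h w != z.
  move=> ilt; apply/andP; rewrite -negb_or.
  by apply: contraL ilt => H; rewrite -leqNgt min // !inE.
case/orP: hn => /eqP hn.
  exact: (exchange_walk fK gK ff gf es exy ezy fx gy fe' ge' wx wz hn before).
apply: (exchange_walk fK gK ff gf es ezy exy fz gy _ ge' wz wx hn).
  by move=> t tz tx; exact: fe'.
by move=> i /before[].
Qed.

(** * Parity, maximum matchings and their modification *)

Lemma even_card_free_involution (T : finType) (f : T -> T) (A : {set T}) :
  involutive f -> {in A, forall t, f t != t} -> {in A, forall t, f t \in A} ->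
  ~~ odd #|A|.
Proof.
move=> fK; have [n] := ubnP #|A|; elim: n => // n IH in A *.
rewrite ltnS => leAn free stab.
have [->|[x xA]] := set_0Vmem A; first by rewrite cards0.
have fxA : f x \in A :\ x by rewrite !inE free ?stab.
rewrite (cardsD1 x) xA (cardsD1 (f x)) fxA /= negbK.
have sub t : t \in A :\ x :\ f x -> [/\ t != f x, t != x & t \in A].
  by rewrite !inE => /and3P[].
apply: IH.
- by move: leAn; rewrite (cardsD1 x) xA (cardsD1 (f x)) fxA /=; lia.
- by move=> t /sub[_ _ /free].
- move=> t /sub[tfx tx tA]; rewrite !inE stab // (inj_eq (inv_inj fK)) tx.
  by rewrite andbT; apply: contraNneq tfx => <-; rewrite fK.
Qed.

Definition fixed (T : finType) (f : T -> T) : {set T} := [set t | f t == t].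

Definition maximum_matching (T : finType) (e : rel T) (f : T -> T) : Prop :=
  rel_matching e f /\
  forall g, rel_matching e g -> #|fixed f| <= #|fixed g|.

Lemma maximum_matching_exists (T : finType) (e : rel T) :
  reflexive e -> exists f, maximum_matching e f.
Proof.
move=> e_refl.
pose P (f : {ffun T -> T}) := [forall t, (f (f t) == t) && e t (f t)].
have P1 : P [ffun t => t] by apply/forallP=> t; rewrite !ffunE eqxx e_refl.
case: (arg_minnP (fun f : {ffun T -> T} => #|fixed f|) P1) => f /forallP Pf min.
exists f; split=> [|g [gK ge]].
  by split=> t; have /andP[/eqP] := Pf t.
have -> : fixed g = fixed [ffun t => g t] by apply/setP=> t; rewrite !inE ffunE.
by apply: min; apply/forallP=> t; rewrite !ffunE gK eqxx ge.
Qed.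

(** Meant for an unmatched [u]: the defect moves from [u] to the former partner of [a]. *)
Definition rematch (T : eqType) (f : T -> T) (a u : T) : T -> T :=
  fun t => if t == a then u else if t == u then a
           else if t == f a then t else f t.

Section Rematch.
Variables (T : finType) (e : rel T) (f : T -> T) (a u : T).
Hypotheses (e_refl : reflexive e) (e_sym : symmetric e).
Hypotheses (f_max : maximum_matching e f) (fu : f u = u).
Hypotheses (au : a != u) (eau : e a u).

Let fK : involutive f. Proof. by case: f_max => -[]. Qed.
Let fe t : e t (f t). Proof. by case: f_max => -[]. Qed.

Let rematchl : rematch f a u a = u. Proof. by rewrite /rematch eqxx. Qed.

Let rematchr : rematch f a u u = a.
Proof. by rewrite /rematch eq_sym (negPf au) eqxx. Qed.

Lemma rematch_old : f a != a -> rematch f a u (f a) = f a.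
Proof.
move=> fa; rewrite /rematch (negPf fa) eqxx.
by rewrite -[X in f a == X]fu (inj_eq (inv_inj fK)) (negPf au).
Qed.

Lemma rematch_out t : t != a -> t != u -> t != f a -> rematch f a u t = f t.
Proof. by rewrite /rematch => /negPf-> /negPf-> /negPf->. Qed.

Lemma rematch_matching : rel_matching e (rematch f a u).
Proof.
have H t : rematch f a u (rematch f a u t) = t /\ e t (rematch f a u t).
  have [->|ta] := eqVneq t a; first by rewrite rematchl rematchr.
  have [->|tu] := eqVneq t u; first by rewrite rematchr rematchl e_sym.
  have [E|tfa] := eqVneq t (f a).
    by rewrite E !rematch_old //; apply: contraNneq ta => fa; rewrite E fa.
  rewrite !rematch_out ?(inj_eq (inv_inj fK)) //.
  - by apply: contraNneq tfa => <-; rewrite fK.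
  - by apply: contraNneq tu => E; rewrite -(fK t) E fu.
by split=> t; case: (H t).
Qed.

Lemma rematch_fixed t :
  (rematch f a u t == t) =
  [&& t != a, t != u & (t == f a) || (f t == t)].
Proof.
have [->|ta] := eqVneq t a; first by rewrite rematchl eq_sym (negPf au).
have [->|tu] := eqVneq t u; first by rewrite rematchr (negPf au).
by rewrite /rematch (negPf ta) (negPf tu) /=; case: (t =P f a) => //= _; rewrite eqxx.
Qed.

(** Otherwise matching [a] with [u] would remove two fixed points. *)
Lemma maximum_matching_fixed : f a != a.
Proof.
apply/eqP => fa; case: f_max => _ /(_ _ rematch_matching).
have -> : fixed (rematch f a u) = fixed f :\ a :\ u.
  apply/setP=> t; rewrite !inE rematch_fixed fa.
  by case: (t == a); case: (t == u).
rewrite [Y in Y <= _](cardsD1 a) inE fa eqxx.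
by rewrite [X in _ + X <= _](cardsD1 u) !inE fu eqxx eq_sym au; lia.
Qed.

(** The fixed point [u] is traded for [f a], so the number of fixed points is unchanged. *)
Lemma rematch_maximum : maximum_matching e (rematch f a u).
Proof.
split=> [|g /f_max.2]; first exact: rematch_matching.
have fa := maximum_matching_fixed.
suff -> : #|fixed (rematch f a u)| = #|fixed f| by [].
have -> : fixed (rematch f a u) = f a |: (fixed f :\ u).
  apply/setP=> t; rewrite !inE rematch_fixed.
  have [->|ta] := eqVneq t a; first by rewrite [a == f a]eq_sym (negPf fa) andbF.
  have [->|//] := eqVneq t u.
  by rewrite -[X in X == f a]fu (inj_eq (inv_inj fK)) eq_sym (negPf au).
rewrite cardsU1 (cardsD1 u (fixed f)) !inE fu eqxx fK (eq_sym a) (negPf fa).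
by rewrite andbF.
Qed.

End Rematch.

(** * Edge-maximal relations and the Tutte barrier *)

Lemma rel_perfect_matchingP (T : finType) (e : rel T) :
  reflect (exists f, rel_perfect_matching e f)
    [exists f : {ffun T -> T},
      [forall t, [&& f (f t) == t, e t (f t) & f t != t]]].
Proof.
apply: (iffP existsP) => [[f /forallP H]|[f [[fK fe] ff]]].
  by exists f; split; [split=> t|move=> t]; have /and3P[/eqP] := H t.
by exists [ffun t => f t]; apply/forallP=> t; rewrite !ffunE fK eqxx fe ff.
Qed.

(** Pairs are added as long as no perfect matching appears; the number of missing pairs
    decreases. *)
Lemma edge_maximal (T : finType) (e : rel T) :
  symmetric e -> (~ exists f, rel_perfect_matching e f) ->
  exists e' : rel T, [/\ subrel e e', symmetric e',
    ~ (exists f, rel_perfect_matching e' f) &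
    forall x z, ~~ e' x z -> exists f, rel_perfect_matching (add_pair e' x z) f].
Proof.
have [n] := ubnP #|[set p : T * T | ~~ e p.1 p.2]|.
elim: n => // n IH in e *; rewrite ltnS => le_n e_sym nopm.
have [/forallP all|] := boolP [forall x, forall z, ~~ e x z ==>
    [exists f : {ffun T -> T}, [forall t,
       [&& f (f t) == t, add_pair e x z t (f t) & f t != t]]]].
  exists e; split=> // x z nxz; apply/rel_perfect_matchingP.
  by have /forallP/(_ z)/implyP := all x; apply.
case/forallPn=> x /forallPn[z]; rewrite negb_imply => /andP[nxz nopm'].
have [|t s||e' [sub e'_sym nopm'' max]] := IH (add_pair e x z).
- apply: leq_trans le_n; apply: proper_card; apply/properP; split.
    by apply/subsetP=> -[s t]; rewrite !inE negb_or => /andP[].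
  by exists (x, z); rewrite !inE //= /add_pair !eqxx orbT.
- by rewrite /add_pair e_sym; congr orb; rewrite orbC ![(_ == _) && (t == _)]andbC.
- by move/rel_perfect_matchingP; apply/negP.
by exists e'; split=> // s t est; apply: sub; rewrite /add_pair est.
Qed.

(* The relation [e'] is edge-maximal without perfect matching, [S] its set of
   universal vertices; [X] picks one vertex in each odd component of its
   complement. *)
Lemma tutte_barrier (T : finType) (e : rel T) :
  symmetric e -> ~~ odd #|T| -> (~ exists f, rel_perfect_matching e f) ->
  exists (e' : rel T) (S X : {set T}),
    [/\ subrel e e', symmetric e' &
        forall y x z, y \notin S -> e' x y -> e' y z -> e' x z] /\
    [/\ {in X & , forall s t, e' s t -> s = t},
        {in X, forall t, t \notin S /\ odd #|[set y | (y \notin S) && e' t y]|} &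
        #|S| < #|X|].
Proof.
move=> e_sym evenT nopm; have [r [sub r_sym nor rmax]] := edge_maximal e_sym nopm.
(* A perfect matching cannot use a pair [x x], so by maximality none is missing. *)
have r_refl : reflexive r.
  move=> x; apply: contraT => nrx; case: nor.
  have [f [[fK fr] ff]] := rmax x x nrx; exists f; split=> //; split=> // t.
  have /or3P[//||] := fr t; case/andP=> /eqP-> /eqP E; by have := ff x; rewrite E eqxx.
have [S SE] : exists S : {set T}, forall s, (s \in S) = [forall t, r s t].
  by exists [set s | [forall t, r s t]] => s; rewrite inE.
have univ s t : s \in S -> r s t by rewrite SE => /forallP.
(* If [x z] were missing, then adding it, or a missing pair [y w], would give two perfect matchings
   to exchange. *)
have trans y x z : y \notin S -> r x y -> r y z -> r x z.
  rewrite SE => /forallPn[w nyw] rxy ryz; apply: contraT => nxz; case: nor.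
  have [f Hf] := rmax _ _ nxz; have [g Hg] := rmax _ _ nyw.
  exact: (rel_perfect_matching_exchange r_sym rxy ryz nxz nyw Hf Hg).
(* Without fixed points the matching would be perfect, and exactly one is excluded by the parity of
   [#|T|]. *)
have two_fixed f v : maximum_matching r f -> exists2 u, f u = u & u != v.
  case=> -[fK fr] _.
  have [/existsP[u /andP[/eqP fu uv]]|] := boolP [exists u, (f u == u) && (u != v)].
    by exists u.
  rewrite negb_exists => /forallP H; exfalso.
  have F t : f t = t -> t = v.
    by move=> ft; have := H t; rewrite ft eqxx negbK => /eqP.
  have [fv|fv] := eqVneq (f v) v; last first.
    case: nor; exists f; split=> // t; apply/eqP=> ft.
    by case/eqP: fv; rewrite -(F t ft).
  have : ~~ odd #|[set~ v]|.
    apply: (even_card_free_involution fK) => t; rewrite !inE.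
      by apply: contra_neq => /F.
    by apply: contra_neq => E; rewrite -(fK t) E fv.
  by move: evenT; rewrite -cardsT (cardsD1 v) inE -setTD /= => /negPf; case: odd.
have fixed_notin f s : maximum_matching r f -> f s = s -> s \notin S.
  move=> fmax fs; apply/negP => sS; have [u fu us] := two_fixed f s fmax.
  have := maximum_matching_fixed r_refl r_sym fmax fu _ (univ s u sS).
  by rewrite eq_sym us fs eqxx => /(_ isT).
have shift f s u : maximum_matching r f -> s \in S -> f u = u ->
    s != u /\ maximum_matching r (rematch f s u).
  move=> fmax sS fu; have su : s != u.
    by apply: contraNneq (fixed_notin f u fmax fu) => <-.
  by split=> //; apply: rematch_maximum => //; exact: univ.
(* Otherwise matching [a] with [u] would leave the universal vertex [f a] unmatched in a maximum
   matching. *)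
have fixed_nonadj f a u : maximum_matching r f -> f a \in S -> f a != a ->
    f u = u -> ~~ r a u.
  move=> fmax faS fa fu; apply/negP => rau.
  have au : a != u by apply: contraNneq fa => ->; rewrite fu.
  have := rematch_maximum r_refl r_sym fmax fu au rau.
  by move/fixed_notin/(_ (rematch_old fmax fu au fa)); rewrite faS.
have [f fmax] := maximum_matching_exists r_refl.
have [[fK fr] _] := fmax.
have f_inj := inv_inj fK.
have fS s : s \in S -> f s \notin S.
  move=> sS; apply/negP => fsS; have [u fu _] := two_fixed f s fmax.
  have [su /fixed_notin H] := shift f s u fmax sS fu.
  have fs : f s != s by apply/eqP=> /(fixed_notin _ _ fmax); rewrite sS.
  by have := H (f s) (rematch_old fmax fu su fs); rewrite fsS.
(* [X] consists of the vertices that a maximum matching does not match inside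
   their own class; each class contains at most one of them. *)
have [X XE] : exists X : {set T}, forall t,
    (t \in X) = (t \notin S) && ((f t == t) || (f t \in S)).
  by exists [set t | (t \notin S) && ((f t == t) || (f t \in S))] => t; rewrite inE.
have uniqX : {in X &, forall s t, r s t -> s = t}.
  move=> a b; rewrite !XE => /andP[aS fa] /andP[bS fb] rab.
  apply/eqP; apply: contraT => ab.
  have key c d : c != d -> r c d -> f c = c -> c \notin S -> d \notin S ->
      (f d == d) || (f d \in S) -> false.
    move=> cd rcd fc cS dS /orP[/eqP fd|fdS].
      have := maximum_matching_fixed r_refl r_sym fmax fd cd rcd.
      by rewrite fc eqxx.
    have := fixed_nonadj f d c fmax fdS _ fc; rewrite r_sym rcd; apply.
    by apply: contraNneq dS => <-.
  case/orP: fa => [/eqP fa|faS]; first exact: (key a b).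
  case/orP: fb => [/eqP fb|fbS].
    by apply: (key b a) => //; rewrite ?faS ?orbT // 1?eq_sym // r_sym.
  have fab : f a != b by apply: contraNneq bS => <-.
  have fba : f b != a by apply: contraNneq aS => <-.
  have faa : f a != a by apply: contraNneq aS => <-.
  have fbb : f b != b by apply: contraNneq bS => <-.
  (* Both are matched into [S]: rematching [f a] with an unmatched [u] frees [a], and [fixed_nonadj]
     applies to [b] and [a]. *)
  have [u fu _] := two_fixed f a fmax.
  have [su gmax] := shift f (f a) u fmax faS fu.
  have ub : b != u by apply: contraNneq fbb => ->; rewrite fu.
  have ga : rematch f (f a) u a = a.
    by have := @rematch_old _ _ f (f a) u fmax fu su; rewrite fK eq_sym; apply.
  have gb : rematch f (f a) u b = f b.
    by rewrite (@rematch_out _ f (f a) u) // 1?eq_sym ?fK // eq_sym.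
  by have := fixed_nonadj _ b a gmax _ _ ga; rewrite gb r_sym rab; apply.
exists r, S, X; do 2!split=> //.
  move=> t tX; have := tX; rewrite XE => /andP[tS ft]; split=> //.
  set C := [set y | _].
  have tC : t \in C by rewrite inE tS r_refl.
  (* Apart from [t] the class contains no vertex of [X], so [f] pairs the others among
     themselves. *)
  rewrite (cardsD1 t) tC /=.
  have sub' y : y \in C :\ t -> [/\ y != t, y \notin S, r t y & y \notin X].
    rewrite !inE => /and3P[yt yS rty]; split=> //.
    by apply: contra yt => yX; rewrite (uniqX t y).
  have inX y : y \notin S -> y \notin X -> f y != y /\ f y \notin S.
    by move=> yS; rewrite XE yS /= negb_or => /andP[].
  apply: (even_card_free_involution fK) => y /sub'[yt yS rty yX];
    have [fy fyS] := inX y yS yX => //.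
  rewrite !inE fyS (trans y) // !andbT.
  apply: contraNneq yS => fyt; move: ft; rewrite -fyt fK.
  by rewrite eq_sym (negPf fy).
have [v _|T0] := pickP (@predT T); last first.
  by case: nor; exists id; split; [split|] => t; have := T0 t.
have [u fu _] := two_fixed f v fmax.
have uS := fixed_notin f u fmax fu.
(* The unmatched [u], in addition to the partners of [S], makes the inequality strict. *)
have sub1 : u |: f @: S \subset X.
  apply/subsetP=> t; rewrite !inE XE => /orP[/eqP->|/imsetP[s sS ->]].
    by rewrite uS fu eqxx.
  by rewrite fS // fK sS orbT.
apply: leq_trans (subset_leq_card sub1).
rewrite cardsU1 card_imset //; suff -> : u \notin f @: S by [].
by apply/imsetP=> -[s sS us]; move: uS; rewrite -fu us fK sS.
Qed.

(** * Incidences and edge boundaries in cubic graphs *)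

Lemma sum_nat_of_bool (T : finType) (P Q : pred T) :
  \sum_(x | P x) (Q x : nat) = #|[set x | P x && Q x]|.
Proof.
by rewrite -sum1dep_card big_mkcondr; apply: eq_bigr => x _; case: (Q x).
Qed.

Section CubicGraphs.
Variable G : graph.

Lemma ends_other (a : edge G) (v : vertex G) :
  v \in ends a -> exists2 w, w != v & ends a = [set v; w].
Proof.
have /eqP/cards2P[x [y [xy ->]]] := card_ends a.
rewrite !inE => /orP[] /eqP->; first by exists y; rewrite // eq_sym.
by exists x; rewrite // setUC.
Qed.

Lemma double_counting (F : {set edge G}) (A : {set vertex G}) :
  \sum_(v in A) #|[set a in F | v \in ends a]| = \sum_(a in F) #|ends a :&: A|.
Proof.
under eq_bigr => v _ do rewrite -sum_nat_of_bool.
rewrite exchange_big /=; apply: eq_bigr => a _; rewrite sum_nat_of_bool.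
by congr #|pred_of_set _|; apply/setP=> v; rewrite !inE andbC.
Qed.

Definition boundary (C : {set vertex G}) : {set edge G} :=
  [set a | #|ends a :&: C| == 1].

Lemma cubic_sum (A : {set vertex G}) :
  cubic G -> \sum_a #|ends a :&: A| = 3 * #|A|.
Proof.
move=> cub; have := double_counting setT A.
rewrite [RHS](eq_bigl xpredT) => [<-|a]; last by rewrite inE.
rewrite mulnC -sum_nat_const; apply: eq_bigr => v _; rewrite -(cub v) /degree.
by congr #|pred_of_set _|; apply/setP=> a; rewrite !inE.
Qed.

Lemma cubic_card : cubic G -> 2 * #|edge G| = 3 * #|vertex G|.
Proof.
move=> cub; rewrite -[#|vertex G|]cardsT -cubic_sum // mulnC -sum_nat_const.
by apply: eq_bigr => a _; rewrite setIT card_ends.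
Qed.

(** Of the [3 * #|C|] incidences with [C], an edge inside [C] accounts for two and a boundary edge
    for one. *)
Lemma odd_boundary (C : {set vertex G}) :
  cubic G -> odd #|boundary C| = odd #|C|.
Proof.
move=> cub; have -> : odd #|C| = odd (\sum_a #|ends a :&: C|).
  by rewrite cubic_sum // oddM.
have -> : \sum_a #|ends a :&: C| =
    #|boundary C| + 2 * \sum_a (#|ends a :&: C| == 2).
  have -> : #|boundary C| = \sum_a (#|ends a :&: C| == 1) by rewrite sum_nat_of_bool.
  rewrite big_distrr -big_split /=.
  apply: eq_bigr => a _; have : #|ends a :&: C| <= 2.
    by rewrite -(card_ends a) subset_leq_card ?subsetIl.
  by case: #|_| => [|[|[|]]].
by rewrite oddD oddM addbF.
Qed.

(** A lone boundary edge would be a bridge: its ends share a component, yet after its deletion no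
    edge leaves [C]. *)
Lemma bridgeless_boundary (C : {set vertex G}) :
  bridgeless G -> #|boundary C| != 1.
Proof.
move=> bl; apply/cards1P => -[a Ea].
have : a \in boundary C by rewrite Ea inE.
rewrite inE => /cards1P[p Ep].
have : p \in ends a :&: C by rewrite Ep inE.
rewrite inE => /andP[pa pC]; have [q qp Eq] := ends_other pa.
have qC : q \notin C.
  apply: contra qp => qC; rewrite -in_set1 -Ep inE qC andbT Eq.
  by rewrite !inE eqxx orbT.
have pcomp : p \in component p by rewrite inE connect0.
have qcomp : q \in component p.
  rewrite inE; apply: connect1; apply/exists_inP; exists a; rewrite ?inE //.
  by rewrite Eq.
have := bl p [set a] _ p q pcomp qcomp; rewrite cards1 => /(_ isT) conn.
have cl : closed (adj (edges_within (component p) :\: [set a])) (mem C).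
  have step x y (b : edge G) : b != a -> ends b = [set x; y] -> x \in C -> y \in C.
    move=> ba Eb xC; apply: contraNT ba => yC; rewrite -in_set1 -Ea inE Eb.
    apply/cards1P; exists x; apply/setP=> z; rewrite !inE.
    have [->|_] := eqVneq z x; first by rewrite xC.
    by have [->|//] := eqVneq z y; rewrite (negPf yC).
  move=> x y /exists_inP[b]; rewrite !inE => /andP[ba _] /eqP Eb.
  by apply/idP/idP; apply: step ba _ => //; rewrite setUC.
by have := closed_connect cl conn; rewrite pC (negPf qC).
Qed.

Lemma odd_boundary_ge3 (C : {set vertex G}) :
  cubic G -> bridgeless G -> odd #|C| -> 3 <= #|boundary C|.
Proof.
move=> cub bl oddC; have := bridgeless_boundary C bl.
by move: oddC; rewrite -odd_boundary //; case: #|_| => [|[|[|]]].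
Qed.

(** * Petersen's theorem *)

Lemma adj_sym (F : {set edge G}) : symmetric (adj F).
Proof. by move=> x y; apply: eq_existsb => a; rewrite setUC. Qed.

Lemma perfect_matching_of_rel (f : vertex G -> vertex G) :
  rel_perfect_matching (adj [set: edge G]) f ->
  exists M : {set edge G}, perfect_matching M.
Proof.
move=> [[fK fe] ff].
(* Among parallel edges one is picked; the choice depends only on the set of ends, hence is the same
   at [v] and [f v]. *)
pose ed v := [pick a | ends a == [set v; f v]].
have edP v : exists2 a, ed v = Some a & ends a = [set v; f v].
  rewrite /ed; case: pickP => [a /eqP Ea|none]; first by exists a.
  by have /exists_inP[a _] := fe v; rewrite none.
have edf v : ed (f v) = ed v by apply: eq_pick => a; rewrite fK setUC.
exists [set a | [exists v, ed v == Some a]]; apply/forallP => v.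
have [a Ea ends_a] := edP v; apply/cards1P; exists a; apply/setP => b.
rewrite !inE; apply/andP/eqP => [[/existsP[w /eqP Ew] vb]|->]; last first.
  by split; [apply/existsP; exists v; rewrite Ea|rewrite ends_a !inE eqxx].
have [b' Eb'] := edP w; rewrite Ew in Eb'; case: Eb' => <- Eb.
move: vb; rewrite Eb !inE => /orP[] /eqP vw; apply: Some_inj;
  by rewrite -Ea vw ?edf.
Qed.

Lemma petersen :
  cubic G -> bridgeless G -> exists M : {set edge G}, perfect_matching M.
Proof.
move=> cub bl; pose e := adj [set: edge G].
have [/rel_perfect_matchingP[f]|/rel_perfect_matchingP nopm] :=
    boolP [exists f : {ffun vertex G -> vertex G},
      [forall t, [&& f (f t) == t, e t (f t) & f t != t]]].
  exact: perfect_matching_of_rel.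
have even_V : ~~ odd #|vertex G|.
  by have /(congr1 odd) := cubic_card cub; rewrite !oddM /= => <-.
have [r [S [X [[sub r_sym trans] [indep oddX]]]]] :=
  tutte_barrier (adj_sym _) even_V nopm.
rewrite ltnNge => /negP[].
pose C t := [set y | (y \notin S) && r t y].
rewrite -(leq_pmul2l (isT : 0 < 3)) -[3 * #|S|]cubic_sum // mulnC -sum_nat_const.
apply: (@leq_trans (\sum_(t in X) #|boundary (C t)|)).
  by apply: leq_sum => t /oddX[_]; exact: odd_boundary_ge3.
have -> : \sum_(t in X) #|boundary (C t)| =
    \sum_a \sum_(t in X) (a \in boundary (C t) : nat).
  rewrite exchange_big /=; apply: eq_bigr => t _.
  by rewrite sum_nat_of_bool; congr #|pred_of_set _|; apply/setP=> a; rewrite inE.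
(* An edge leaving a class ends in [S], as otherwise transitivity would keep it in the class. It
   leaves only one class, since distinct members of [X] are unrelated. *)
apply: leq_sum => a _.
have [/exists_inP[t tX]|none] := boolP [exists t in X, a \in boundary (C t)];
  last first.
  rewrite big1 // => t tX; apply/eqP; rewrite eqb0.
  by apply: contra none => ab; apply/exists_inP; exists t.
rewrite inE => /cards1P[p Ep].
have : p \in ends a :&: C t by rewrite Ep inE.
rewrite inE => /andP[pa pC]; have [q qp Eq] := ends_other pa.
have := pC; rewrite inE => /andP[pS rtp].
have rpq : r p q by apply: sub; apply/exists_inP; exists a; rewrite ?inE ?Eq.
have qC : q \notin C t.
  apply: contra qp => qC; rewrite -in_set1 -Ep inE qC andbT Eq.
  by rewrite !inE eqxx orbT.
have qS : q \in S.
  by apply: contraNT qC => qS; rewrite inE qS (trans p).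
rewrite (bigD1 t) //= big1 ?addn0 => [|s /andP[sX st]].
  apply: leq_trans (leq_b1 _) _; apply/card_gt0P; exists q.
  by rewrite inE qS Eq !inE eqxx orbT.
apply/eqP; rewrite eqb0 inE; apply: contra st => /cards1P[p' Ep'].
have : p' \in ends a :&: C s by rewrite Ep' inE.
rewrite Eq !inE => /and3P[/orP[/eqP->|/eqP->]]; last by rewrite qS.
move=> _ rsp; apply/eqP; apply: indep => //.
by apply: trans pS rsp _; rewrite r_sym.
Qed.

End CubicGraphs.

(** * Averaging over the deleted matching *)

Section Averaging.
Variables (T : finType) (n : nat) (M : 'I_n.+1 -> {set T}).

(* An element covered once survives the deletion of all sets but one, an
   element covered twice survives every deletion. *)
Lemma sum_card_bigcup_lift :
  n * #|\bigcup_i M i| + #|[set a | 1 < #|[set i | a \in M i]|]| <=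
  \sum_(i < n.+1) #|\bigcup_(j < n) M (lift i j)|.
Proof.
(* [K a] collects the indices whose deletion leaves [a] covered. *)
pose K a := [set i : 'I_n.+1 | a \in \bigcup_(j < n) M (lift i j)].
have -> : \sum_(i < n.+1) #|\bigcup_(j < n) M (lift i j)| = \sum_a #|K a|.
  transitivity (\sum_(i < n.+1) \sum_a (a \in \bigcup_(j < n) M (lift i j) : nat)).
    apply: eq_bigr => i _; rewrite sum_nat_of_bool.
    by congr #|pred_of_set _|; apply/setP=> a; rewrite inE.
  by rewrite exchange_big /=; apply: eq_bigr => a _; rewrite sum_nat_of_bool.
rewrite -sum1_card big_mkcond big_distrr /= -sum1dep_card [X in _ + X]big_mkcond.
rewrite -big_split /=; apply: leq_sum => a _.
have KP i0 i : a \in M i0 -> i != i0 -> i \in K a.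
  move=> ai0 /unlift_some[j Ej _]; rewrite inE; apply/bigcupP.
  by exists j => //; rewrite -Ej.
have [/bigcupP[i0 _ ai0]|na] := boolP (a \in _); last first.
  rewrite muln0; case: ifP => // /card_gt1P[i [_ [iM _ _]]].
  by move: na; rewrite inE in iM; case/bigcupP; exists i.
rewrite muln1; case: ifP => [/card_gt1P[i1 [i2 [i1M i2M i12]]]|_].
  rewrite !inE in i1M i2M; rewrite addn1; suff -> : K a = setT by rewrite cardsT card_ord.
  apply/setP=> i; rewrite in_setT; have [E|] := eqVneq i i1; last exact: KP.
  by apply: KP i2M _; rewrite E.
rewrite addn0; have cardC : #|[set~ i0]| = n by rewrite cardsC1 card_ord.
rewrite -[X in X <= _]cardC.
by apply/subset_leq_card/subsetP=> i; rewrite in_setC1; exact: KP.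
Qed.

End Averaging.

(* Pigeonhole: at least four matchings share the three edges at a vertex. *)
Lemma cubic_covered_twice (G : graph) (k : nat) (M : 'I_k -> {set edge G}) :
  cubic G -> 3 < k -> (forall i, perfect_matching (M i)) ->
  #|vertex G| <= 2 * #|[set a | 1 < #|[set i | a \in M i]|]|.
Proof.
move=> cub k4 pm; set W := [set a | _].
have : \sum_(v in [set: vertex G]) #|[set a in W | v \in ends a]| = 2 * #|W|.
  rewrite double_counting mulnC -sum_nat_const; apply: eq_bigr => a _.
  by rewrite setIT card_ends.
(* It suffices that every vertex [v] meets [W]: otherwise the [k] matchings would use distinct edges
   among the three at [v]. *)
move=> <-; rewrite -cardsT -sum1_card; apply: leq_sum => v _.
rewrite lt0n; apply: contraTneq k4 => /cards0_eq none; rewrite -leqNgt.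
rewrite -(cub v) /degree.
have -> : k = \sum_(a | v \in ends a) #|[set i | a \in M i]|.
  transitivity (\sum_(i < k) \sum_(a | v \in ends a) (a \in M i : nat)).
    rewrite -[LHS]card_ord -[LHS]sum1_card; apply: eq_bigr => i _; rewrite sum_nat_of_bool.
    have /forallP/(_ v)/eqP <- := pm i.
    by congr #|pred_of_set _|; apply/setP=> a; rewrite !inE andbC.
  by rewrite exchange_big /=; apply: eq_bigr => a _; rewrite sum_nat_of_bool.
rewrite -sum1dep_card; apply: leq_sum => a va; rewrite leqNgt.
by apply/negP => H; have := in_set0 a; rewrite -none 2!inE va andbT H.
Qed.

Local Open Scope ring_scope.

(** * Bounds on [m] *)

Lemma m_ge (G : graph) (t : nat) (M : 'I_t -> {set edge G}) :
  (forall i, perfect_matching (M i)) ->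
  #|\bigcup_(i < t) M i|%:R / #|edge G|%:R <= m t G.
Proof.
move=> pm; pose F := [ffun i => M i].
have -> : \bigcup_(i < t) M i = \bigcup_(i < t) F i.
  by apply: eq_bigr => i _; rewrite ffunE.
apply: (le_bigmax_cond 0
  (fun F : {ffun 'I_t -> {set edge G}} => #|\bigcup_(i < t) F i|%:R / #|edge G|%:R : rat)).
by apply/forallP=> i; rewrite ffunE.
Qed.

(** Each of the [n.+1] unions that omit one matching has at most [m n G * #|edge G|] edges; the
    edges covered twice contribute the [1 / 3]. *)
Lemma m_ge_of_matchings (G : graph) (n : nat) (M : 'I_n.+1 -> {set edge G}) :
  (0 < #|vertex G|)%N -> cubic G -> (3 < n.+1)%N ->
  (forall i, perfect_matching (M i)) ->
  n%:R * (#|\bigcup_i M i|%:R / #|edge G|%:R) + 1 / 3 <= n.+1%:R * m n G.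
Proof.
move=> V0 cub n4 pm.
have VE := cubic_card cub.
have E0 : (0 < #|edge G|)%N by lia.
have E0' : 0 < #|edge G|%:R :> rat by rewrite ltr0n.
have H1 := sum_card_bigcup_lift M.
have H2 := cubic_covered_twice cub n4 pm.
set W := #|[set a | _]| in H1 H2.
(* Half the number of vertices is a third of the number of edges. *)
have H3 : (#|edge G| <= 3 * W)%N by lia.
have H4 : (\sum_(i < n.+1) #|\bigcup_(j < n) M (lift i j)|)%N%:R <=
    n.+1%:R * m n G * #|edge G|%:R :> rat.
  rewrite natr_sum -mulrA mulr_natl -[n.+1 in X in _ <= X]card_ord -sumr_const.
  apply: ler_sum => i _; rewrite -ler_pdivrMr //.
  exact: (@m_ge G n (fun j => M (lift i j))).
rewrite -(ler_pM2r E0') mulrDl -mulrA divfK ?gt_eqF //.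
apply: le_trans H4; apply: le_trans (_ : (n * #|\bigcup_i M i| + W)%N%:R <= _); last first.
  by rewrite ler_nat.
rewrite natrD natrM lerD2l mulrAC ler_pdivrMr // mul1r mulrC -natrM ler_nat //.
Qed.

Theorem theorem11 (G : graph) (k : nat) :
  (0 < #|vertex G|)%N -> cubic G -> bridgeless G -> (4 <= k)%N ->
  m (k - 1)%N G >= (k%:R - 1) / k%:R * m k G + 1 / (3 * k%:R).
Proof.
case: k => // n V0 cub bl n4; rewrite subn1 /=.
have [P pmP] := petersen cub bl.
have n0 : 0 < n%:R :> rat by rewrite ltr0n; lia.
have bound (M : 'I_n.+1 -> {set edge G}) : (forall i, perfect_matching (M i)) ->
    #|\bigcup_i M i|%:R / #|edge G|%:R <= (n.+1%:R * m n G - 1 / 3) / n%:R.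
  move=> pm; rewrite ler_pdivlMr // lerBrDr mulrC.
  exact: m_ge_of_matchings.
have : m n.+1 G <= (n.+1%:R * m n G - 1 / 3) / n%:R.
  rewrite {1}/m; apply: bigmax_le => [|M /forallP]; last exact: bound.
  (* The default value 0 of the maximum must also lie below the bound; the constant family [P] shows
     this. *)
  by apply: le_trans (bound (fun=> P) (fun=> pmP)); rewrite divr_ge0 ?ler0n.
rewrite ler_pdivlMr // lerBrDr => H.
have -> : n.+1%:R - 1 = n%:R :> rat by rewrite -natr1 addrK.
have k0 : 0 < n.+1%:R :> rat by rewrite ltr0n.
have -> : n%:R / n.+1%:R * m n.+1 G + 1 / (3 * n.+1%:R) =
    (m n.+1 G * n%:R + 1 / 3) / n.+1%:R.
  by field; rewrite addrC natr1 gt_eqF.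
by rewrite ler_pdivrMr // [m n G * _]mulrC.
Qed.
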